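(* Let $K$ be a nonempty compact Hausdorff space and let $\Phi$ be a closed subspace of $\mathcal{C}(K)$ which separates points of $K$ and contains the constant functions. Let $f:K\to\mathbb{R}$ be an upper semicontinuous convex-trace function with respect to $\Phi$. Then there exists $\bar x\in\partial_\Phi(K)$ such that $f(\bar x)=\max_{x\in K}f(x)$.
   Context: $\mathcal{C}(K)$ is the Banach space of continuous real-valued functions on $K$ with the sup-norm, and $w^*$ is the weak-star topology of $\Phi^*$. $K(\Phi):=\{Q\in\Phi^*:\ \|Q\|=\langle Q,\mathbf 1\rangle=1\}$ (with $\mathbf 1$ the constant function $1$), a convex $w^*$-compact subset of $\Phi^*$. $\delta^\Phi:K\to K(\Phi)$ is $\delta^\Phi(x)(\phi)=\phi(x)$. A function $f:K\to\mathbb{R}$ is upper semicontinuous (usc) convex-trace with respect to $\Phi$ if $f=F\circ\delta^\Phi$ for some convex $w^*$-upper semicontinuous $F:K(\Phi)\to\mathbb{R}$. For $x\in K$, $\mathcal{M}_x(\Phi)$ is the set of Borel (Radon) probability measures $\mu$ on $K$ with $\phi(x)=\int_K\phi\,d\mu$ for all $\phi\in\Phi$. The $\Phi$-Choquet boundary is $\partial_\Phi(K):=\{x\in K:\ \mathcal{M}_x(\Phi)=\{\delta_x\}\}$, where $\delta_x$ is the Dirac measure at $x$; equivalently (a known fact), $\partial_\Phi(K)=\{x\in K:\ \delta^\Phi(x)\in\mathrm{Ext}(K(\Phi))\}$. *)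

(* Defs.v *)
From HB Require Import structures.
From mathcomp Require Import all_boot all_order all_algebra.
From mathcomp Require Import all_classical all_reals all_analysis.

Set Implicit Arguments.
Unset Strict Implicit.
Unset Printing Implicit Defensive.

Import Order.TTheory GRing.Theory Num.Theory.
Import numFieldNormedType.Exports.

Local Open Scope classical_set_scope.
Local Open Scope ring_scope.

(* The Banach space C(K). The compactness proof is a parameter of the type
   because the sup-norm axioms depend on it; nonemptiness of K is the point
   carried by [ptopologicalType]. *)
Definition cfun (R : realType) (K : ptopologicalType)
  (cK : compact [set: K]) : Type := continuousType K R.

Section cfun_normed.
Context (R : realType) (K : ptopologicalType) (cK : compact [set: K]).
Local Notation CK := (cfun R cK).
Implicit Types f g : CK.

Definition cfun_fun f : K -> R := Continuous.sort f.

Let cfunP f g : cfun_fun f =1 cfun_fun g -> f = g.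
Proof. by move=> fg; apply/continuousEP. Qed.

Let cfun_cts f : continuous (cfun_fun f).
Proof. exact: (@cts_fun _ _ f). Qed.

Let add_cts f g : continuous (fun x => cfun_fun f x + cfun_fun g x).
Proof. by move=> x; apply: cvgD; exact: cfun_cts. Qed.

Let opp_cts f : continuous (fun x => - cfun_fun f x).
Proof. by move=> x; apply: cvgN; exact: cfun_cts. Qed.

Let scale_cts (a : R) f : continuous (fun x => a * cfun_fun f x).
Proof. by move=> x; apply: cvgMl_tmp; exact: cfun_cts. Qed.

Definition cfun_add f g : CK := mkcts (@add_cts f g).
Definition cfun_opp f : CK := mkcts (@opp_cts f).
Definition cfun_scale (a : R) f : CK := mkcts (@scale_cts a f).
Definition cfun_cst (c : R) : CK := cst c.

HB.instance Definition _ := Choice.copy CK (continuousType K R).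

Let addA : associative cfun_add.
Proof. by move=> f g h; apply: cfunP => x; exact: addrA. Qed.
Let addC : commutative cfun_add.
Proof. by move=> f g; apply: cfunP => x; exact: addrC. Qed.
Let add0 : left_id (cfun_cst 0) cfun_add.
Proof. by move=> f; apply: cfunP => x; exact: add0r. Qed.
Let addN : left_inverse (cfun_cst 0) cfun_opp cfun_add.
Proof. by move=> f; apply: cfunP => x; exact: addNr. Qed.

HB.instance Definition _ := GRing.isZmodule.Build CK addA addC add0 addN.

Let scaleA a b f : cfun_scale a (cfun_scale b f) = cfun_scale (a * b) f.
Proof. by apply: cfunP => x; exact: mulrA. Qed.
Let scale1 : left_id 1 cfun_scale.
Proof. by move=> f; apply: cfunP => x; exact: mul1r. Qed.
Let scaleDr : right_distributive cfun_scale +%R.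
Proof. by move=> a f g; apply: cfunP => x; exact: mulrDr. Qed.
Let scaleDl f : {morph cfun_scale^~ f : a b / a + b}.
Proof. by move=> a b; apply: cfunP => x; exact: mulrDl. Qed.

HB.instance Definition _ :=
  GRing.Zmodule_isLmodule.Build R CK scaleA scale1 scaleDr scaleDl.

Definition sup_norm f : R := sup [set `|cfun_fun f x| | x in [set: K]].

Let has_sup_norm f : has_sup [set `|cfun_fun f x| | x in [set: K]].
Proof.
apply: compact_has_sup; first by exists `|cfun_fun f point|, point.
apply: continuous_compact cK; apply: continuous_subspaceT => x.
by apply: cvg_norm; exact: cfun_cts.
Qed.

Lemma le_sup_norm f x : `|cfun_fun f x| <= sup_norm f.
Proof. by apply: sup_upper_bound => //; exists x. Qed.

Lemma sup_norm_le f c : (forall x, `|cfun_fun f x| <= c) -> sup_norm f <= c.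
Proof.
move=> fc; apply: ge_sup; first by exists `|cfun_fun f point|, point.
by move=> _ [x _ <-].
Qed.

Let sup_normD f g : sup_norm (f + g) <= sup_norm f + sup_norm g.
Proof.
apply: sup_norm_le => x; apply: le_trans (ler_normD _ _) _.
by apply: lerD; exact: le_sup_norm.
Qed.

Let sup_normZ a f : sup_norm (a *: f) = `|a| * sup_norm f.
Proof.
have H b h : sup_norm (b *: h) <= `|b| * sup_norm h.
  apply: sup_norm_le => x; rewrite [cfun_fun _ x]/(b * cfun_fun h x) normrM.
  by apply: ler_wpM2l => //; exact: le_sup_norm.
have [->|a0] := eqVneq a 0.
  apply/eqP; rewrite normr0 mul0r eq_le; apply/andP; split.
    by apply: le_trans (H _ _) _; rewrite normr0 mul0r.
  exact: le_trans (normr_ge0 _) (le_sup_norm _ point).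
apply/eqP; rewrite eq_le H/= -ler_pdivlMl ?normr_gt0// -normfV.
by rewrite -{1}[f](scalerK a0); exact: H.
Qed.

Let sup_norm0_eq0 f : sup_norm f = 0 -> f = 0.
Proof.
move=> f0; apply: cfunP => x; apply/eqP; rewrite -normr_le0 -f0.
exact: le_sup_norm.
Qed.

HB.instance Definition _ :=
  Lmodule_isNormed.Build R CK sup_normD sup_normZ sup_norm0_eq0.

End cfun_normed.

Coercion cfun_fun : cfun >-> Funclass.

Section submod_normed.
Context (R : realType) (V : normedModType R) (Phi : submodClosed V).

Definition submod_of : Type := {v : V | v \in Phi}.

HB.instance Definition _ := SubChoice.on submod_of.
HB.instance Definition _ := [SubChoice_isSubLmodule of submod_of by <:].

Let submod_norm (v : submod_of) : R := `|val v|.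

Let submod_normD v w : submod_norm (v + w) <= submod_norm v + submod_norm w.
Proof. exact: ler_normD. Qed.
Let submod_normZ a v : submod_norm (a *: v) = `|a| * submod_norm v.
Proof. exact: normrZ. Qed.
Let submod_norm0 v : submod_norm v = 0 -> v = 0.
Proof. by move/normr0_eq0 => v0; exact: val_inj. Qed.

HB.instance Definition _ :=
  Lmodule_isNormed.Build R submod_of submod_normD submod_normZ submod_norm0.

End submod_normed.

Section dual.
Context (R : realType) (V : normedModType R).

Definition dual_pred : {pred V -> R^o} :=
  [pred Q | `[< scalar Q /\ continuous (Q : V -> R) >]].

Let dual_submod : submod_closed dual_pred.
Proof.
split=> [|a P Q /asboolP[lP cP] /asboolP[lQ cQ]]; apply/asboolP; split.
- by move=> a u v; rewrite mulr0 addr0.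
- exact: cst_continuous.
- move=> b u v; rewrite ![(a *: P + Q) _]/(a * P _ + Q _) lP lQ.
  by rewrite !mulrDr addrACA mulrCA.
- by move=> x; apply: cvgD; [apply: cvgMl_tmp; exact: cP|exact: cQ].
Qed.

HB.instance Definition _ :=
  GRing.isSubmodClosed.Build R (V -> R^o) dual_pred dual_submod.

Record dual := Dual { dual_fun :> V -> R^o ; dualP : dual_fun \in dual_pred }.

HB.instance Definition _ := [isSub for dual_fun].
HB.instance Definition _ := [Choice of dual by <:].
HB.instance Definition _ := [SubChoice_isSubLmodule of dual by <:].

(* The canonical topology of the dual is the weak-star one; the dual norm is
   the plain function [dual_norm]. *)
HB.instance Definition _ := Topological.copy dual
  (initial_topology (dual_fun : dual -> {ptws V -> R})).

Definition dual_norm (Q : dual) : R :=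
  sup [set `|Q v| | v in [set v : V | `|v| <= 1]].

End dual.

Definition upper_semicontinuous (R : realType) (X : topologicalType)
    (f : X -> R) :=
  forall x a, f x < a -> \forall y \near x, f y < a.

Section choquet.
Context (R : realType) (K : ptopologicalType) (cK : compact [set: K]).
Variable Phi : submodClosed (cfun R cK).

Definition separates_points :=
  forall x y : K, x <> y -> exists2 phi : cfun R cK, phi \in Phi & phi x <> phi y.

Definition has_constants := forall c : R, cfun_cst cK c \in Phi.

Let evalP (x : K) :
  (fun phi : submod_of Phi => val phi x : R^o) \in @dual_pred R (submod_of Phi).
Proof.
apply/asboolP; split=> [//|phi].
apply/(@cvgrPdist_lt _ _ _ (nbhs phi)) => e e0.
apply/(@nbhs_normP R (submod_of Phi)); exists e => //= psi phipsi; apply: le_lt_trans phipsi.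
exact: (le_sup_norm (val (phi - psi)) x).
Qed.

Definition delta (x : K) : dual (submod_of Phi) := Dual (evalP x).

Definition submod_one (Phi1 : has_constants) : submod_of Phi :=
  Sub (cfun_cst cK 1) (Phi1 1).

Definition state_space (Phi1 : has_constants) : set (dual (submod_of Phi)) :=
  [set Q | dual_norm Q = 1 /\ Q (submod_one Phi1) = 1].

(* F is a total function on the dual, but only its values on the state space
   are constrained: [subspace] carries the relative weak-star topology. *)
Definition usc_convex_trace (Phi1 : has_constants) (f : K -> R) :=
  exists F : dual (submod_of Phi) -> R,
    [/\ convex_function (state_space Phi1) F,
        upper_semicontinuous (F : subspace (state_space Phi1) -> R) &
        f = F \o delta].

Definition borel : measurableType (@open K).-sigma :=
  g_sigma_algebraType (@open K).

(* Local finiteness is automatic for a probability measure. *)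
Definition radon (mu : probability borel R) :=
  forall A : set borel, measurable A ->
    mu A = ereal_sup [set mu C | C in [set C : set K | compact C /\ C `<=` A]].

Definition representing (x : K) : set (probability borel R) :=
  [set mu | radon mu /\ forall phi : cfun R cK, phi \in Phi ->
     ((phi x)%:E = \int[mu]_y (phi y)%:E)%E].

(* A library measure is a function on all subsets of its carrier, with
   unspecified values on non-measurable ones, so the equality of M_x(Phi) with
   the singleton of the Dirac measure is taken up to agreement on Borel sets. *)
Definition choquet_boundary : set K :=
  [set x | forall mu : probability borel R, representing x mu <->
    (forall A : set borel, measurable A -> mu A = \d_(x : borel) A)].

End choquet.

(* Main.v *)
Require Import Defs.
From mathcomp Require Import all_boot all_order all_algebra.
From mathcomp Require Import all_classical all_reals all_analysis.
From mathcomp Require Import measurable_realfun.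
From mathcomp Require Import lra.

(** The proof combines Bauer's maximum principle with Milman's theorem, both
    taken relative to the states of Phi that come from means.

    A mean is a finitely additive analogue of [(A, u) |-> \int_A u dmu], with
    [A] Borel and [u] in Phi. By Tychonoff the means form a compact space, so
    the states [u |-> m (setT, u)] form a weak-star compact set [mean_states]
    ([mean_states_compact]) containing every evaluation [delta x]. The point
    of this set is that each of its elements carries an explicit decomposition
    along any Borel set [A], because a mean can be conditioned on [A] and on
    its complement ([mean_restrictP]), and that every Borel probability
    measure induces one of its elements ([measure_meanP]).

    Bauer's principle ([bauer_maximum]) gives an extreme point [Q] of
    [mean_states] at which the convex usc [F] is maximal. If a mean [m] induces
    [Q] and [m (A, 1) > 0], then splitting [m] along [A] writes [Q] as a convex
    combination of two states of the same set, so extremality forces the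
    normalised restriction of [m] to [A] to induce [Q] again. Hence [Q u <= c]
    whenever [u <= c] on [A] ([extreme_mean_le]). A point [x] all of whose
    neighbourhoods have positive mass therefore satisfies [Q u <= u x] for all
    [u], that is [Q = delta x]; by compactness such a point exists in every
    compact set of positive mass ([extreme_mean_support]).

    This is used twice. On the whole of [K] it gives [Q = delta xbar], which
    makes [xbar] a maximum point of [f]. On a compact set [D] avoiding [xbar]
    that has positive mass for some [mu] representing [xbar], it would give
    [y] in [D] with [delta y = delta xbar], against separation of points. So
    [mu] vanishes on the compact sets avoiding [xbar], and inner regularity
    turns it into the Dirac measure. *)

Set Implicit Arguments.
Unset Strict Implicit.
Unset Printing Implicit Defensive.

Import Order.TTheory GRing.Theory Num.Theory.
Import numFieldNormedType.Exports.

Local Open Scope classical_set_scope.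
Local Open Scope ring_scope.

(** * Maximum sets of upper semicontinuous functions *)

Section compactness.
Context (R : realType) (T : topologicalType).
Implicit Types C Z : set T.

(** The members of the chain are a filter base, and a cluster point of the
    filter they generate lies in each of them because they are closed. *)
Lemma compact_chain (I : Type) (D : set I) (Z : I -> set T) C :
  compact C -> D !=set0 ->
  (forall i, D i -> [/\ closed (Z i), Z i !=set0 & Z i `<=` C]) ->
  (forall i j, D i -> D j -> Z i `<=` Z j \/ Z j `<=` Z i) ->
  \bigcap_(i in D) Z i !=set0.
Proof.
move=> cC [i0 Di0] hZ chainZ.
have FF : ProperFilter (filter_from D Z).
  apply: filter_from_proper; last by move=> i /hZ[].
  apply: filter_from_filter; first by exists i0.
  move=> i j Di Dj; have [ij|ji] := chainZ i j Di Dj.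
    by exists i => // x Zx; split=> //; exact: ij.
  by exists j => // x Zx; split=> //; exact: ji.
have [|p [_ clp]] := cC _ FF.
  by exists i0 => //; have [_ _] := hZ _ Di0.
exists p => i Di; have [cZ _ _] := hZ _ Di; apply: cZ => B nB.
by apply: clp nB; exists i.
Qed.

Definition argmax_set C (g : T -> R) : set T :=
  [set x | C x /\ forall y, C y -> g y <= g x].

(** Off [C] the points of [subspace C] are isolated, so upper semicontinuity
    there is a condition at the points of [C] only. *)
Lemma usc_withinP C (g : T -> R) :
  upper_semicontinuous (g : subspace C -> R) <->
  forall x a, C x -> g x < a -> \forall y \near x, C y -> g y < a.
Proof.
split=> [uscg x a Cx gxa|uscg x a gxa].
  have := uscg x a gxa.
  rewrite /prop_near1 (_ : nbhs (x : subspace C) = within C (nbhs (x : T)))//.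
  by rewrite nbhs_subspace_in.
rewrite /prop_near1; have [Cx|nCx] := pselect (C x).
  rewrite (_ : nbhs (x : subspace C) = within C (nbhs (x : T))); first exact: uscg.
  by rewrite nbhs_subspace_in.
rewrite (_ : nbhs (x : subspace C) = globally [set x]); first by move=> y ->.
exact: (esym (@nbhs_subspace_out T C x nCx)).
Qed.

Lemma superlevel_closed C (g : T -> R) c : closed C ->
  upper_semicontinuous (g : subspace C -> R) ->
  closed [set x | C x /\ c <= g x].
Proof.
move=> clC uscg x clx.
have Cx : C x by apply: clC => B /clx[y [[Cy _] By]]; exists y.
split=> //; rewrite leNgt; apply/negP => gxc.
have /usc_withinP/(_ x c Cx gxc)/clx[y [[Cy cy] /(_ Cy)]] := uscg.
by rewrite ltNge cy.
Qed.

Lemma argmax_set_closed C (g : T -> R) : closed C ->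
  upper_semicontinuous (g : subspace C -> R) -> closed (argmax_set C g).
Proof.
move=> clC uscg.
rewrite (_ : argmax_set C g =
    C `&` \bigcap_(y in C) [set x | C x /\ g y <= g x]).
  apply: closedI => //; apply: closed_bigI => y _.
  exact: superlevel_closed.
apply/seteqP; split=> x [Cx gx]; split=> // y Cy; first by split; auto.
by have [] := gx _ Cy.
Qed.

(** The superlevel sets at the values of [g] form a chain of nonempty closed
    sets; a common point is a maximum point. *)
Lemma argmax_set_neq0 C (g : T -> R) : compact C -> closed C -> C !=set0 ->
  upper_semicontinuous (g : subspace C -> R) -> argmax_set C g !=set0.
Proof.
move=> cC clC C0 uscg.
have [||x xP] := @compact_chain _ C (fun y => [set x | C x /\ g y <= g x]) C cC C0.
- move=> y Cy; split; last by move=> x [].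
    exact: superlevel_closed.
  by exists y.
- move=> y z _ _; case/orP: (le_total (g y) (g z)) => yz; [right|left];
    by move=> x [Cx h]; split=> //; apply: le_trans h.
exists x; split; last by move=> y /xP[].
by have [y /xP[]] := C0.
Qed.

Lemma upper_semicontinuousS C D (g : T -> R) : C `<=` D ->
  upper_semicontinuous (g : subspace D -> R) ->
  upper_semicontinuous (g : subspace C -> R).
Proof.
move=> CD /usc_withinP uscg; apply/usc_withinP => x a Cx gxa.
apply: filterS (uscg x a (CD _ Cx) gxa) => y h Cy.
exact/h/CD.
Qed.

Lemma continuous_usc C (g : T -> R) : continuous g ->
  upper_semicontinuous (g : subspace C -> R).
Proof.
move=> cg; apply/usc_withinP => x a _ gxa.
near=> y => _; near: y; apply: (cg x [set r | r < a]).
exact: lt_nbhsl.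
Unshelve. all: by end_near.
Qed.

End compactness.

(** * The maximum principle in a weak-star compact set *)

Section bauer.
Context (R : realType) (V : normedModType R).
Implicit Types (C S : set (dual V)) (F : dual V -> R).

Lemma dual_eval_continuous (v : V) : continuous (fun Q : dual V => Q v : R).
Proof.
move=> Q U nU.
have h := @proj_continuous V (fun=> R) v (dual_fun Q) U nU.
exact: (@initial_continuous (dual V) {ptws V -> R} (@dual_fun R V) Q _ h).
Qed.

Lemma dual_hausdorff : hausdorff_space (dual V).
Proof.
move=> P Q clPQ; apply/val_inj/funext => v /=.
apply: (@Rhausdorff R) => A B nA nB.
have [x [Ax Bx]] := clPQ _ _ (@dual_eval_continuous v _ _ nA)
                             (@dual_eval_continuous v _ _ nB).
by exists (x v).
Qed.

Definition face C S := forall (t : R) (P Q : dual V), 0 < t < 1 ->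
  C P -> C Q -> S (t *: P + (1 - t) *: Q) -> S P /\ S Q.

(** A convex combination with weights in ]0, 1[ reaches the maximum of a convex
    function only if both of its terms do. *)
Lemma face_argmax C S F : face C S -> S `<=` C -> convex_function C F ->
  face C (argmax_set S F).
Proof.
move=> fS SC cF t P Q /andP[t0 t1] CP CQ [SPQ maxPQ].
have [SP SQ] : S P /\ S Q by apply: (fS t) => //; rewrite t0.
have t01 : 0 <= t <= 1 by rewrite !ltW.
have : F (t *: P + (1 - t) *: Q) <= t * F P + (1 - t) * F Q.
  have := cF (Itv01 (ltW t0) (ltW t1)) P Q.
  by rewrite !inE; exact.
have FP := maxPQ _ SP; have FQ := maxPQ _ SQ => h.
have eP : F P = F (t *: P + (1 - t) *: Q) by nra.
have eQ : F Q = F (t *: P + (1 - t) *: Q) by nra.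
by split; split=> // y Sy; rewrite ?eP ?eQ; exact: maxPQ.
Qed.

Record closed_face C S : Prop := ClosedFace {
  closed_face_closed : closed S;
  closed_face_neq0 : S !=set0;
  closed_face_sub : S `<=` C;
  closed_face_face : face C S }.

Lemma closed_face_argmax C S F : compact C -> closed_face C S ->
  convex_function C F -> upper_semicontinuous (F : subspace S -> R) ->
  closed_face C (argmax_set S F).
Proof.
move=> cC [clS S0 SC fS] cF uscF; split.
- exact: argmax_set_closed.
- by apply: argmax_set_neq0 => //; exact: subclosed_compact SC.
- by move=> P [/SC].
- exact: face_argmax.
Qed.

(** Zorn's lemma, for the inclusion of the complements in [S]. *)
Lemma minimal_closed_face C S : compact C -> closed_face C S ->
  exists S', [/\ closed_face C S', S' `<=` S &
    forall S'', closed_face C S'' -> S'' `<=` S' -> S'' = S'].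
Proof.
move=> cC cfS; have [clS S0 SC fS] := cfS.
have [|A [cfA maxA]] := @Zorn_bigcup _ [set A | closed_face C (S `\` A)].
  move=> /= H cfH chainH; have [->|H0] := eqVneq H set0.
    by rewrite bigcup_set0 setD0.
  have {}H0 : H !=set0 by exact/set0P.
  have -> : S `\` \bigcup_(X in H) X = \bigcap_(X in H) (S `\` X).
    apply/seteqP; split=> [P [SP nP] X HX|P hP].
      by split=> // XP; apply: nP; exists X.
    have [X0 HX0] := H0; split; first by have [] := hP _ HX0.
    by move=> [X HX XP]; have [_] := hP _ HX.
  split.
  - by apply: closed_bigI => X /cfH[].
  - apply: compact_chain cC H0 _ _; first by move=> X /cfH[].
    by move=> X Y HX HY; have [XY|YX] := chainH X Y HX HY;
      [right|left]; exact: setDS.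
  - by have [X0 HX0] := H0; move=> P /(_ _ HX0)[/SC].
  - move=> t P Q t01 CP CQ h; split=> X HX;
      by have [_ _ _ /(_ t P Q t01 CP CQ (h X HX))[]] := cfH X HX.
exists (S `\` A); split; [exact: cfA|by move=> P []|].
move=> S' cfS' S'A; apply/seteqP; split=> // P [SP nAP].
apply: contrapT => nS'P.
have SS' : S `\` ~` S' = S'.
  by rewrite setDE setCK; apply/setIidr => Q /S'A[].
apply: (maxA (~` S')); last by rewrite /= SS'.
split; first by move=> Q AQ /S'A[].
by move=> /(_ P nS'P).
Qed.

(** A minimal closed face inside the maximum set is a singleton: the evaluation
    at each [v] is affine and continuous, so it is constant on that face, since
    its maximum set there is again a closed face. *)
Theorem bauer_maximum C F : compact C -> C !=set0 -> convex_function C F ->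
  upper_semicontinuous (F : subspace C -> R) ->
  exists Q, [/\ C Q, face C [set Q] & forall P, C P -> F P <= F Q].
Proof.
move=> cC C0 cF uscF.
have cfC : closed_face C C.
  by split=> //; exact: compact_closed dual_hausdorff cC.
have [S [cfS SM minS]] := minimal_closed_face cC (closed_face_argmax cC cfC cF uscF).
have [clS [Q SQ] SC fS] := cfS.
(* P' maximises the evaluation at v over S, because the maximum set is a
   closed face inside the minimal face S. *)
have evS v P P' : S P -> S P' -> P v <= P' v :> R.
  have convex_ev : convex_function C (fun P : dual V => P v : R).
    by move=> t x y _ _.
  have eS := minS _ (closed_face_argmax cC cfS convex_ev
    (continuous_usc (@dual_eval_continuous v))) (fun _ => @proj1 _ _).
  by move=> SP; rewrite -{1}eS => -[_]; exact.
have eqQ P : S P -> P = Q.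
  move=> SP; apply/val_inj/funext => v; apply/eqP.
  by rewrite eq_le; apply/andP; split; exact: evS.
have eS : [set Q] = S by apply/seteqP; split=> [_ ->//|P /eqQ].
exists Q; split; first exact: SC.
  by rewrite eS.
by have [] := SM _ SQ.
Qed.

End bauer.

(** * Means and the states they induce *)

Section closure_relations.
Context (R : realType) (T : topologicalType).
Implicit Types (X : set T) (f g : T -> R).

Lemma continuous_addf f g : continuous f -> continuous g ->
  continuous (fun x => f x + g x).
Proof. by move=> cf cg x; apply: cvgD; [exact: cf|exact: cg]. Qed.

Lemma continuous_scalef a f : continuous f -> continuous (fun x => a * f x).
Proof. by move=> cf x; apply: cvgMl_tmp; exact: cf. Qed.

Lemma closure_le X f g x : continuous f -> continuous g ->
  (forall y, X y -> f y <= g y) -> closure X x -> f x <= g x.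
Proof.
move=> cf cg fg clx; rewrite -subr_ge0 leNgt; apply/negP => gf.
have cgf : continuous (g \- f) by move=> y; apply: cvgB; [exact: cg|exact: cf].
have [y [Xy]] := clx _ (cgf x _ (lt_nbhsl gf)).
by rewrite /= ltNge subr_ge0 fg.
Qed.

Lemma closure_eq X f g x : continuous f -> continuous g ->
  (forall y, X y -> f y = g y) -> closure X x -> f x = g x.
Proof.
move=> cf cg fg clx; apply/eqP; rewrite eq_le.
by rewrite !(closure_le _ _ _ clx)// => y /fg ->.
Qed.

Lemma continuous_ptws (I : eqType) (U : topologicalType)
    (f : T -> {ptws I -> U}) :
  (forall i, continuous (fun x => f x i)) -> continuous f.
Proof.
move=> cf x; apply/cvg_sup => i; apply/cvg_image.
  by apply/seteqP; split=> // r _; exists (fun=> r).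
move=> W nW; exists ((fun q : I -> U => q i) @^-1` W); first exact: (cf i x).
by apply/seteqP; split=> [_ [q Wq <-]//|r Wr]; exists (fun=> r).
Qed.

End closure_relations.

Section means.
Context (R : realType) (K : ptopologicalType) (cK : compact [set: K]).
Variables (Phi : submodClosed (cfun R cK)) (Phi1 : has_constants Phi).

Local Notation E := (submod_of Phi).
Local Notation one := (submod_one Phi1).
Local Notation M := {ptws set (borel K) * E -> R}.
Implicit Types (A B D N : set (borel K)) (u v : E).

(** The model is [m (A, u) = \int_A u dmu]. [mean_le] contains positivity:
    apply it to [u = - 1] and [c = 0]. The index ranges over all sets, and not
    only over the Borel ones, in order that means live in a plain product
    space; [mean_nonmeas] then fixes the coordinates that carry no
    information, so that every coordinate stays bounded. *)
Record mean (m : M) : Prop := Mean {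
  mean_linear : forall A a u v, m (A, a *: u + v) = a * m (A, u) + m (A, v);
  mean_le : forall A u c, (forall x, A x -> val u x <= c) ->
    m (A, u) <= c * m (A, one);
  mean_split : forall A B u, measurable A -> measurable B ->
    m (A, u) = m (A `&` B, u) + m (A `\` B, u);
  mean_total : m (setT, one) = 1;
  mean_nonmeas : forall A u, ~ measurable A -> m (A, u) = 0 }.

Lemma val_le_norm u (x : K) : val u x <= `|u|.
Proof. exact: le_trans (ler_norm _) (le_sup_norm (val u) x). Qed.

Section mean_theory.
Variable m : M.
Hypothesis mP : mean m.

Lemma mean_0 A : m (A, 0) = 0.
Proof.
have := mean_linear mP A 1 0 0; rewrite scale1r addr0 mul1r; lra.
Qed.

Lemma mean_opp A u : m (A, - u) = - m (A, u).
Proof.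
have := mean_linear mP A (-1) u 0.
by rewrite scaleN1r addr0 mean_0 addr0 mulN1r.
Qed.

Lemma mean_sub A u v : m (A, u - v) = m (A, u) - m (A, v).
Proof.
have := mean_linear mP A 1 u (- v).
by rewrite scale1r mul1r mean_opp.
Qed.

Lemma mean_one_ge0 A : 0 <= m (A, one).
Proof.
have := mean_le mP (A := A) (u := - one) (c := 0).
by rewrite mul0r mean_opp oppr_le0; apply => x _; exact: lerN10.
Qed.

Lemma mean_norm A u : `|m (A, u)| <= `|u| * m (A, one).
Proof.
rewrite ler_norml -lerNl; apply/andP; split.
  rewrite -mean_opp; apply: mean_le => // x _.
  by rewrite -normrN; exact: val_le_norm.
by apply: mean_le => // x _; exact: val_le_norm.
Qed.

Lemma mean_one_mono A B : measurable A -> measurable B -> A `<=` B ->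
  m (A, one) <= m (B, one).
Proof.
move=> mA mB /setIidr AB; rewrite (mean_split mP one mB mA) setIC.
by rewrite setIC AB lerDl mean_one_ge0.
Qed.

Lemma mean_one_le1 A : m (A, one) <= 1.
Proof.
have [mA|nA] := pselect (measurable A); last by rewrite mean_nonmeas.
by rewrite -(mean_total mP); exact: mean_one_mono.
Qed.

Lemma mean_le_norm A u : `|m (A, u)| <= `|u|.
Proof.
apply: le_trans (mean_norm A u) _.
by rewrite ler_piMr// mean_one_le1.
Qed.

Lemma mean_set0 : m (set0, one) = 0.
Proof.
have := mean_split mP one (@measurable0 _ (borel K)) (@measurable0 _ (borel K)).
by rewrite setI0 setD0; lra.
Qed.

Lemma mean_null_setU A B : measurable A -> measurable B ->
  m (A, one) = 0 -> m (B, one) = 0 -> m (A `|` B, one) = 0.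
Proof.
move=> mA mB A0 B0.
have mAB : measurable (A `|` B) by exact: measurableU.
rewrite (mean_split mP one mAB mA).
have -> : (A `|` B) `&` A = A by apply/setIidr; exact: subsetUl.
rewrite A0 add0r setDUl setDv set0U.
apply/eqP; rewrite eq_le mean_one_ge0 andbT -B0.
by apply: mean_one_mono => //; exact: measurableD.
Qed.

Lemma mean_complement A u : measurable A -> m (~` A, u) = m (setT, u) - m (A, u).
Proof.
move=> mA; rewrite (mean_split mP u (@measurableT _ (borel K)) mA).
by rewrite setTI setTD addrAC subrr add0r.
Qed.

Lemma mean_dual : (fun u => m (setT, u) : R^o) \in @dual_pred R E.
Proof.
apply/asboolP; split=> [a u v|u]; first exact: mean_linear.
apply/(@cvgrPdist_lt _ _ _ (nbhs u)) => e e0.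
apply/(@nbhs_normP R E); exists e => //= v uv.
by rewrite -mean_sub; apply: le_lt_trans uv; exact: mean_le_norm.
Qed.

Definition mean_state : dual E := Dual mean_dual.

Lemma mean_state_in_state_space : state_space Phi1 mean_state.
Proof.
split; last exact: mean_total.
have ub : ubound [set `|mean_state v| | v in [set v : E | `|v| <= 1]] 1.
  by move=> _ [v v1 <-]; apply: le_trans v1; exact: mean_le_norm.
apply/eqP; rewrite eq_le; apply/andP; split.
  by apply: ge_sup ub; exists `|mean_state 0|, 0 => //=; rewrite normr0.
apply: ub_le_sup; first by exists 1.
exists one; last by rewrite /= mean_total// normr1.
by apply: sup_norm_le => x; rewrite /= normr1.
Qed.

(** The conditional mean given [A]. *)
Definition mean_restrict A : M :=
  fun i => if `[< measurable i.1 >] then m (A `&` i.1, i.2) / m (A, one) else 0.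

Lemma mean_restrictP A : measurable A -> 0 < m (A, one) ->
  mean (mean_restrict A).
Proof.
move=> mA A0; rewrite /mean_restrict; split => /=.
- move=> B a u v; case: ifPn => _; last by rewrite mulr0 addr0.
  by rewrite mean_linear// mulrDl mulrA.
- move=> B u c uc; case: ifPn => _; last by rewrite mulr0.
  rewrite mulrA ler_wpM2r ?invr_ge0 ?(ltW A0)//.
  by apply: mean_le => // x [_ /uc].
- move=> B D u mB mD; rewrite !asboolT//; last 2 first.
  - exact: measurableD.
  - exact: measurableI.
  by rewrite (mean_split mP u (measurableI _ _ mA mB) mD) mulrDl setIDA setIA.
- by rewrite asboolT// setIT divff// gt_eqF.
- by move=> B u nB; rewrite asboolF.
Qed.

End mean_theory.

(** Means lie in a product of segments by [mean_le_norm], and each defining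
    condition is a relation between finitely many coordinates, stable under
    pointwise limits. *)
Lemma means_compact : compact (mean : set M).
Proof.
pose box := [set m : M |
  forall i, `[- `|i.2|, `|i.2|]%classic (m i)].
have cbox : compact box.
  apply: (@tychonoff _ (fun=> R : topologicalType)
    (fun i : set (borel K) * E => `[- `|i.2|, `|i.2|]%classic)) => i.
  exact: segment_compact.
apply: subclosed_compact cbox _; last first.
  move=> m mP [A u]; rewrite /= in_itv/= -ler_norml.
  exact: (mean_le_norm mP).
have ev i : continuous (fun m : M => m i).
  exact: (@proj_continuous _ (fun=> R : topologicalType) i).
move=> m clm; split.
- move=> A a u v.
  apply: (closure_eq (T := M) (f := fun m => m (A, a *: u + v))
    (g := fun m => a * m (A, u) + m (A, v)) _ _ _ clm); first exact: ev.
    by apply: continuous_addf; [apply: continuous_scalef|]; exact: ev.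
  by move=> m' /mean_linear ->.
- move=> A u c uc.
  apply: (closure_le (T := M) (f := fun m => m (A, u))
    (g := fun m => c * m (A, one)) _ _ _ clm); first exact: ev.
    by apply: continuous_scalef; exact: ev.
  by move=> m' /mean_le; exact.
- move=> A B u mA mB.
  apply: (closure_eq (T := M) (f := fun m => m (A, u))
    (g := fun m => m (A `&` B, u) + m (A `\` B, u)) _ _ _ clm); first exact: ev.
    by apply: continuous_addf; exact: ev.
  by move=> m' /mean_split; exact.
- apply: (closure_eq (T := M) (f := fun m => m (setT, one)) (g := fun=> 1) _ _ _ clm).
  + exact: ev.
  + exact: cst_continuous.
  + by move=> m' /mean_total.
- move=> A u nA.
  apply: (closure_eq (T := M) (f := fun m => m (A, u)) (g := fun=> 0) _ _ _ clm).
  + exact: ev.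
  + exact: cst_continuous.
  + by move=> m' /mean_nonmeas; exact.
Qed.

(** By the Hahn-Banach and Riesz theorems this is the whole state space; being
    defined through means, it comes with its own representations. *)
Definition mean_states : set (dual E) :=
  [set Q | exists2 m, mean m & forall u, Q u = m (setT, u)].

Lemma mean_states_compact : compact mean_states.
Proof.
pose st (m : M) : dual E :=
  if pselect (mean m) is left mP then mean_state mP else 0.
have -> : mean_states = st @` mean.
  apply/seteqP; split=> [Q [m mP Qm]|_ [m mP <-]].
    exists m => //; rewrite /st; case: pselect => // mP'.
    by apply/val_inj/funext => u; rewrite /= Qm.
  by exists m => //; rewrite /st; case: pselect.
apply: continuous_compact means_compact.
apply: (@continuous_comp_initial _ (subspace mean) {ptws E -> R}
  (@dual_fun R E) st).
pose ev (m : M) : {ptws E -> R} :=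
  fun u => m (setT, u).
apply: (@subspace_eq_continuous _ mean {ptws E -> R} ev).
  move=> m /set_mem mP; apply/funext => u.
  by rewrite /= /st; case: pselect.
apply: (@continuous_subspaceT M {ptws E -> R}).
apply: (@continuous_ptws M E R ev) => u.
exact: (@proj_continuous _ (fun=> R : topologicalType) (setT, u)).
Qed.

Lemma mean_states_sub : mean_states `<=` state_space Phi1.
Proof.
move=> Q [m mP Qm]; rewrite (_ : Q = mean_state mP).
  exact: mean_state_in_state_space.
by apply/val_inj/funext => u; rewrite /= Qm.
Qed.

(** With [t = m (A, 1)], the state [Q] is the combination, with weights [t] and
    [1 - t], of the states of [m] conditioned on [A] and on its complement.
    Extremality identifies [Q] with the first one, which is an average over
    [A]. When [t = 1] the complement is null and [Q] is this average at once. *)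
Lemma extreme_mean_le (Q : dual E) m A u c :
  face mean_states [set Q] -> mean m -> (forall v, Q v = m (setT, v)) ->
  measurable A -> 0 < m (A, one) -> (forall x, A x -> val u x <= c) ->
  Q u <= c :> R.
Proof.
move=> extQ mP Qm mA A0 uc.
have Ac0 := mean_one_ge0 mP (~` A).
have A1 : m (A, one) + m (~` A, one) = 1.
  by rewrite (mean_complement mP)// (mean_total mP) addrC subrK.
(* The combination degenerates when the complement of A is null. *)
have [Ac|Acn] := eqVneq (m (~` A, one)) 0.
  have : m (~` A, u) = 0.
    apply/eqP; rewrite -normr_le0; apply: le_trans (mean_norm mP _ _) _.
    by rewrite Ac mulr0.
  rewrite (mean_complement mP)// -Qm => /eqP; rewrite subr_eq0 => /eqP ->.
  apply: le_trans (mean_le mP uc) _.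
  by move: A1; rewrite Ac addr0 => ->; rewrite mulr1.
have Acgt0 : 0 < m (~` A, one) by rewrite lt_neqAle eq_sym Acn.
have mAc : measurable (~` A) by exact: measurableC.
have rP := mean_restrictP mP mA A0; have rcP := mean_restrictP mP mAc Acgt0.
have [] := extQ (m (A, one)) (mean_state rP) (mean_state rcP).
- by rewrite A0 /=; lra.
- by exists (mean_restrict m A).
- by exists (mean_restrict m (~` A)).
- have -> : 1 - m (A, one) = m (~` A, one) by lra.
  apply/val_inj/funext => v.
  rewrite [LHS]/(m (A, one) * mean_restrict m A (setT, v) +
                 m (~` A, one) * mean_restrict m (~` A) (setT, v)).
  rewrite /mean_restrict/= asboolT//.
  rewrite !setIT !(mulrC (m (_, one))) !divfK ?gt_eqF//.
  by rewrite (mean_complement mP)// Qm; exact: subrKC.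
move=> <- _; rewrite /= /mean_restrict/= asboolT// setIT.
by rewrite ler_pdivrMr//; exact: (mean_le mP).
Qed.

(** The sets [D `\` N] with [N] null generate a proper filter on the compact
    [D]. A neighbourhood of a cluster point [x] meets [D] in positive mass, so
    [extreme_mean_le] bounds [Q v] by numbers arbitrarily close to [v x]; the
    same for [- v] gives equality. *)
Lemma extreme_mean_support (Q : dual E) m D :
  face mean_states [set Q] -> mean m -> (forall v, Q v = m (setT, v)) ->
  compact (D : set K) -> measurable D -> 0 < m (D, one) ->
  exists2 x, D x & Q = delta Phi x.
Proof.
move=> extQ mP Qm cD mD D0.
pose F := filter_from [set N | measurable N /\ m (N, one) = 0] (setD (D : set K)).
have FF : ProperFilter F.
  apply: filter_from_proper; first apply: filter_from_filter.
  - by exists set0; split=> //; exact: (mean_set0 mP).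
  - move=> N1 N2 [mN1 N10] [mN2 N20]; exists (N1 `|` N2); last by rewrite setDUr.
    split; first exact: measurableU.
    exact: (mean_null_setU mP).
  - move=> N [mN N0]; apply/set0P/eqP => DN0.
    have : m (D, one) <= m (N, one).
      by apply: (mean_one_mono mP) => //; rewrite -setD_eq0.
    by rewrite N0; lra.
have [|x [Dx clx]] := cD F FF.
  by exists set0; [split=> //; exact: (mean_set0 mP)|rewrite setD0].
exists x => //; apply/val_inj/funext => u.
suff le_ux v : Q v <= val v x :> R.
  apply/eqP; rewrite eq_le; apply/andP; split; first exact: le_ux.
  have := le_ux (- u).
  by rewrite /= !Qm (mean_opp mP) lerN2.
rewrite leNgt; apply/negP => vQ.
(* U is the neighbourhood of x on which v stays below the midpoint c, so
   positive mass of D `&` U would give Q v <= c. *)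
pose c := (val v x + Q v) / 2.
have [vc cQ] : val v x < c /\ c < Q v by split; rewrite /c; lra.
pose U : set K := [set y | val v y < c].
have cv : continuous (val v : K -> R) by exact: (@cts_fun _ _ (val v)).
have oU : open U by apply: open_comp (@open_lt _ c) => y _; exact: cv.
have mU : measurable (U : set (borel K)) by exact: sub_sigma_algebra.
have mUD : measurable (D `&` U : set (borel K)) by exact: measurableI.
have : Q v <= c :> R; last by lra.
apply: (extreme_mean_le extQ mP Qm mUD); last by move=> y [_ /ltW].
rewrite lt_neqAle (mean_one_ge0 mP) andbT eq_sym; apply/negP => /eqP N0.
have [||y [[Dy nDU] Uy]] := clx (D `\` (D `&` U)) U.
- by exists (D `&` U).
- exact: (open_nbhs_nbhs (conj oU vc)).
- exact: nDU.
Qed.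

End means.

(** * Borel probability measures as means *)

Section measure_means.
Context (R : realType) (K : ptopologicalType) (cK : compact [set: K]).
Variables (Phi : submodClosed (cfun R cK)) (Phi1 : has_constants Phi).

Local Notation E := (submod_of Phi).
Local Notation one := (submod_one Phi1).
Implicit Types (A B D N : set (borel K)) (u v : E) (mu : probability (borel K) R).
Local Notation M := {ptws set (borel K) * E -> R}.
Local Notation mean := (@mean R K cK Phi Phi1).

Lemma continuous_borel_measurable (g : K -> R) : continuous g ->
  measurable_fun setT (g : borel K -> R).
Proof.
move=> cg; apply: (measurability _ (RGenOpens.measurableE R)).
move=> _ [_ [a [b ->] <-]]; rewrite setTI; apply: sub_sigma_algebra.
by apply: open_comp => [x _|]; [exact: cg|exact: interval_open].
Qed.

Lemma cfun_integrable mu A (g : cfun R cK) : measurable A ->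
  mu.-integrable A (EFin \o (g : borel K -> R)).
Proof.
move=> mA; apply: measurable_bounded_integrable => //.
- by apply: le_lt_trans (probability_le1 mu mA) _; rewrite ltry.
- apply: measurable_funTS; apply: continuous_borel_measurable.
  exact: (@cts_fun _ _ g).
- exists `|g|; split=> // r gr x _ /=.
  exact: le_trans (le_sup_norm g x) (ltW gr).
Qed.

Definition measure_mean mu : M := fun i =>
  if `[< measurable i.1 >] then \int[mu]_(x in i.1) val i.2 x else 0.

Lemma measure_meanE mu A u : measurable A ->
  measure_mean mu (A, u) = \int[mu]_(x in A) val u x.
Proof. by move=> mA; rewrite /measure_mean asboolT. Qed.

Lemma measure_mean_one mu A : measurable A ->
  measure_mean mu (A, one) = fine (mu A).
Proof.
by move=> mA; rewrite measure_meanE// Rintegral_cst// mul1r.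
Qed.

Lemma measure_meanP mu : mean (measure_mean mu).
Proof.
split.
- move=> A a u v; rewrite /measure_mean/=; case: ifPn => [/asboolP mA|_].
    have iu := cfun_integrable mu (val u) mA.
    have iv := cfun_integrable mu (val v) mA.
    rewrite -RintegralZl// -RintegralD//.
    exact: (cfun_integrable mu (a *: val u) mA).
  by rewrite mulr0 addr0.
- move=> A u c uc; have [mA|nA] := pselect (measurable A); last first.
    by rewrite /measure_mean/= !asboolF// mulr0.
  rewrite measure_mean_one// measure_meanE// -Rintegral_cst//.
  apply: le_Rintegral => //; first exact: cfun_integrable.
  exact: (cfun_integrable mu (cfun_cst cK c) mA).
- move=> A B u mA mB.
  have mAB : measurable (A `&` B) by exact: measurableI.
  have mADB : measurable (A `\` B) by exact: measurableD.
  rewrite !measure_meanE// -{1}(setUIDK A B) Rintegral_setU//.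
    by rewrite setUIDK; exact: cfun_integrable.
  by apply/disj_setPS => x [[_ Bx] [_ /(_ Bx)]].
- by rewrite measure_mean_one// probability_setT.
- by move=> A u nA; rewrite /measure_mean/= asboolF.
Qed.

Lemma representing_mean mu x : representing Phi x mu ->
  forall u, delta Phi x u = measure_mean mu (setT, u).
Proof.
move=> [_ rep] u; rewrite measure_meanE//; apply: EFin_inj.
rewrite /Rintegral fineK; first exact: (rep (val u) (valP u)).
by apply: integrable_fin_num => //; exact: cfun_integrable.
Qed.

Hypothesis hK : hausdorff_space K.

Lemma measurable_set1_borel (x : K) : measurable ([set x] : set (borel K)).
Proof.
rewrite -(setCK [set x]); apply: measurableC; apply: sub_sigma_algebra.
by apply: closed_openC; exact: (accessible_closed_set1 (hausdorff_accessible hK)).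
Qed.

Lemma compact_borel_measurable (D : set K) : compact D ->
  measurable (D : set (borel K)).
Proof.
move=> cD; rewrite -(setCK D); apply: measurableC; apply: sub_sigma_algebra.
by apply: closed_openC; exact: compact_closed.
Qed.

Lemma dirac_representing mu (x : K) :
  (forall A, measurable A -> mu A = \d_(x : borel K) A) ->
  representing Phi x mu.
Proof.
move=> muE; split=> [A mA|g _].
  rewrite muE// diracE; apply/eqP; rewrite eq_le; apply/andP; split.
    have [xA|xA] := boolP (x \in A); last first.
      apply: ereal_sup_ubound; exists set0; last by rewrite measure0.
      by split=> //; exact: compact0.
    apply: ereal_sup_ubound; exists [set x].
      by split; [exact: compact_set1|move=> _ ->; exact: set_mem].
    rewrite muE; last exact: measurable_set1_borel.
    by rewrite diracE mem_set.
  apply: ge_ereal_sup => _ [D [cD DA] <-].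
  rewrite muE; last exact: compact_borel_measurable.
  rewrite diracE lee_fin ler_nat.
  have [/set_mem/DA/mem_set -> //|//] := boolP (x \in (D : set (borel K))).
rewrite (eq_measure_integral (\d_(x : borel K))); last by move=> A mA _; exact: muE.
rewrite integral_dirac//; first by rewrite diracT mul1e.
apply/measurable_EFinP; apply: continuous_borel_measurable.
exact: (@cts_fun _ _ g).
Qed.

Lemma delta_mean_states (x : K) : mean_states Phi1 (delta Phi x).
Proof.
exists (measure_mean (\d_(x : borel K))); first exact: measure_meanP.
by apply: representing_mean; exact: dirac_representing.
Qed.

(** Inner regularity makes every Borel set missing [x] null; the value on a set
    containing [x] follows by complementation. *)
Lemma radon_dirac mu (x : K) : radon mu ->
  (forall D : set K, compact D -> ~ D x -> mu D = 0%E) ->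
  forall A, measurable A -> mu A = \d_(x : borel K) A.
Proof.
move=> rmu mu0.
have null A : measurable A -> ~ A x -> mu A = 0%E.
  move=> mA nAx; rewrite (rmu A mA); apply/eqP; rewrite eq_le.
  apply/andP; split.
    apply: ge_ereal_sup => _ [D [cD DA] <-].
    by rewrite mu0// => /DA.
  apply: ereal_sup_ubound; exists set0; last by rewrite measure0.
  by split=> //; exact: compact0.
move=> A mA; rewrite diracE; have [xA|xA] := boolP (x \in A).
  rewrite -(setCK A) probability_setC; last exact: measurableC.
  rewrite null ?sube0//; first exact: measurableC.
  by apply; exact: set_mem.
by rewrite null// => /mem_set; apply/negP.
Qed.

End measure_means.

Theorem theorem28 (R : realType) (K : ptopologicalType)
    (cK : compact [set: K]) (hK : hausdorff_space K)
    (Phi : submodClosed (cfun R cK))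
    (Phi_closed : closed [set` Phi])
    (Phi_sep : separates_points Phi)
    (Phi1 : has_constants Phi)
    (f : K -> R) (hf : usc_convex_trace Phi1 f) :
  exists2 xbar : K, choquet_boundary Phi xbar & forall x : K, f x <= f xbar.
Proof.
have [F [cvxF uscF fF]] := hf.
have sub := @mean_states_sub _ _ _ _ Phi1.
have cvxF' : convex_function (mean_states Phi1) F.
  by move=> t P Q /set_mem/sub/mem_set HP /set_mem/sub/mem_set HQ; exact: cvxF.
have S0 : mean_states Phi1 !=set0.
  by exists (delta Phi point); exact: delta_mean_states.
have [Q [[m mP Qm] extQ maxQ]] := bauer_maximum (@mean_states_compact _ _ _ _ Phi1)
  S0 cvxF' (upper_semicontinuousS sub uscF).
have [|xbar _ Qx] := extreme_mean_support extQ mP Qm cK (@measurableT _ (borel K)).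
  by rewrite (mean_total mP).
exists xbar; last first.
  by move=> x; rewrite fF /= -Qx; apply: maxQ; exact: delta_mean_states.
move=> mu; split; last exact: dirac_representing.
move=> repmu; apply: radon_dirac => //; first by have [] := repmu.
move=> D cD nDx.
have mD := compact_borel_measurable hK cD.
have [//|D0] := eqVneq (mu D) 0%E.
have [||y Dy Qy] := extreme_mean_support extQ (measure_meanP Phi1 mu) _ cD mD.
- by move=> v; rewrite Qx; exact: representing_mean.
- rewrite measure_mean_one//; apply: fine_gt0.
  by rewrite lt0e D0 measure_ge0/= (le_lt_trans (probability_le1 mu mD))// ltry.
have [yx|/eqP /Phi_sep[phi Pphi]] := eqVneq y xbar; first by rewrite -yx in nDx.
case; rewrite -[phi y]/(delta Phi y (Sub phi Pphi)).
by rewrite -Qy Qx.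
Qed.
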